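(* Let $C=C(d)$ for a fixed integer $d>1$ and fix any constant $\epsilon>0$. For $\vec{\bm x}$ drawn uniformly from $[0:M-1]^n$ and any integer $\tau$ satisfying $|\tau|=o(Mn)$, we have \[ \Pr_{\vec{\bm x}}\big[\exists\,\vec c\in C^n:\ \vec{\bm x}\cdot\vec c=\tau\big]\;\; \begin{cases}\ge 1-o_n(1) & \text{if } M\le |C|^{(1-\epsilon)n},\\[0.3ex] \le |C|^n/M & \text{if } M\ge |C|^n.\end{cases} \]
   Context: $[a:b]=\{a,a+1,\dots,b\}$ and $C(d)=\{\pm1,\pm2,\dots,\pm d\}$. Asymptotics are as $n\to\infty$ with $d,\epsilon$ fixed; $M$ and $\tau$ may depend on $n$. Standing assumption: $M=|C|^{\Omega(n)}$. *)

(* Defs.v *)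
From HB Require Import structures.
From mathcomp Require Import all_boot all_order all_algebra finmap.
From mathcomp Require Import all_classical all_reals all_analysis.

Set Implicit Arguments.
Unset Strict Implicit.
Unset Printing Implicit Defensive.

Import Order.TTheory GRing.Theory Num.Theory.
Import numFieldNormedType.Exports.

Local Open Scope ring_scope.

Definition coefs (d : nat) : {fset int} :=
  ([fset k%:Z | k in iota 1 d] `|` [fset - k%:Z | k in iota 1 d])%fset.

(* Probability of A under the uniform distribution on T (0 if T is empty). *)
Definition unif_prob (R : realType) (T : finType) (A : {set T}) : R :=
  #|A|%:R / #|T|%:R.

(* 'I_M is [0 : M-1], so x ranges over [0 : M-1]^n; c ranges over C^n. *)
Definition solvable_instances (n M : nat) (C : {fset int}) (tau : int)
    : {set {ffun 'I_n -> 'I_M}} :=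
  [set x : {ffun 'I_n -> 'I_M} |
    [exists c : {ffun 'I_n -> C},
      \sum_(i < n) (x i : nat)%:Z * fsval (c i) == tau]]%SET.

(* Main.v *)
Require Import Defs.
From HB Require Import structures.
From mathcomp Require Import all_boot all_order all_algebra finmap.
From mathcomp Require Import all_classical all_reals all_analysis.
From mathcomp Require Import ring lra zify.

Set Implicit Arguments.
Unset Strict Implicit.
Unset Printing Implicit Defensive.

Import Order.TTheory GRing.Theory Num.Theory.
Import numFieldNormedType.Exports.

Local Open Scope classical_set_scope.
Local Open Scope ring_scope.

(** Upper bound: once all but the first entry of [x] are fixed, [x.c = tau] has at
most one solution in that entry, since [0] is not a coefficient; then a union
bound over [c].

Lower bound: split [x] into one entry [y], a block [x_A] of [b] entries and a
block [x_B] of [m] entries, [m] a small constant fraction of [n]. With high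
probability [x_B] steers: for each integer [r] with [|r| <= T] some signs [c_B]
bring [x_B.c_B] within [E = M/k] of [r]. So for every [s] in [[-W, W]] there are
signs with [w_s := tau - x_B.c_B] within [E] of [s]. Apply the second moment
method to the number of pairs [(c_A, s)] with [y + x_A.c_A = w_s], over random
[(y, x_A)] with [x_B] fixed. The expectation is close to [|C|^b], because
[x_A.c_A] is usually below [W] by Chebyshev. For the second moment, a pair
[(c_A, c_A')] typically has a coordinate [j] with entries [1] and [2]; the two
equations are then unimodular in [(y, x_j)], so the pair behaves as if
independent up to a factor [(1 + 6E/M)^2], without any local limit theorem.
Exceptional pairs are exponentially rare, and the diagonal is negligible since
[M <= |C|^((1 - eps) n)]. *)

(** * Redrawing one coordinate, and Chebyshev's inequality for counts *)

Definition upd (I T : finType) (x : {ffun I -> T}) (j : I) (z : T) :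
    {ffun I -> T} :=
  [ffun i => if i == j then z else x i].

Lemma upd_same (I T : finType) (x : {ffun I -> T}) j z : upd x j z j = z.
Proof. by rewrite ffunE eqxx. Qed.

Lemma upd_other (I T : finType) (x : {ffun I -> T}) j z i :
  i != j -> upd x j z i = x i.
Proof. by rewrite ffunE => /negPf ->. Qed.

(* Redrawing coordinate j leaves a uniform x uniform. *)
Lemma sum_resample (V : nmodType) (I T : finType) (j : I)
    (F : {ffun I -> T} -> V) :
  \sum_x \sum_z F (upd x j z) = (\sum_x F x) *+ #|T|.
Proof.
pose h (p : {ffun I -> T} * T) := (upd p.1 j p.2, p.1 j).
have hK : involutive h.
  case=> x z; rewrite /h /= upd_same; congr pair.
  by apply/ffunP=> i; rewrite !ffunE; case: eqP => [->|].
rewrite pair_big /= (reindex_inj (inv_inj hK)) /=.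
under eq_bigr => p _.
  rewrite (_ : upd _ _ _ = p.1); last first.
    by rewrite -[RHS]/(p.1) -[in RHS](hK p).
  over.
rewrite -(pair_big predT predT (fun x (_ : T) => F x)) /=.
by under eq_bigr do rewrite sumr_const; rewrite sumrMnl.
Qed.

(** Variance of a sum of independent centered variables: a cross term with [i != j] vanishes because
    redrawing coordinate [i] averages [h i] to zero. The factor [#|T|] is multiplied out to avoid
    normalizing. *)
Lemma sum_sqr_centered (R : realFieldType) (I T : finType) (h : I -> T -> R) :
  (forall i, \sum_t h i t = 0) ->
  (\sum_(x : {ffun I -> T}) (\sum_i h i (x i)) ^+ 2) * #|T|%:R
  = (\sum_i \sum_t h i t ^+ 2) * #|{ffun I -> T}|%:R.
Proof.
move=> h0.
under eq_bigr do rewrite expr2 big_distrlr /=.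
rewrite exchange_big /= mulr_suml [RHS]mulr_suml; apply: eq_bigr => i _.
rewrite exchange_big /= (bigD1 i) //= [X in _ + X]big1 ?addr0 => [|j ji]; last first.
  have /(congr1 (fun y => y / #|T|%:R)) :=
    sum_resample j (fun x : {ffun I -> T} => h i (x i) * h j (x j)).
  rewrite [in LHS]big1 ?mul0r => [|x _].
    (* For empty [T] the division does not cancel, but then no [x] can be evaluated at [i]. *)
    have [T0|T0] := posnP #|T|.
      move=> _; apply: big1 => x _.
      by have := fintype0 (x i) T0.
    by rewrite -[X in X / _]mulr_natr mulfK // pnatr_eq0 -lt0n.
  under eq_bigr do rewrite upd_same upd_other 1?eq_sym //.
  by rewrite -mulr_sumr h0 mulr0.
rewrite mulr_natr -(sum_resample i).
transitivity (\sum_(x : {ffun I -> T}) \sum_t h i t ^+ 2).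
  by apply: eq_bigr => x _; apply: eq_bigr => z _; rewrite upd_same expr2.
by rewrite sumr_const mulr_natr.
Qed.

(** Chebyshev's inequality, with [v] bounding the variance of each summand. It serves twice: over
    random entries of the steering block, and over random coefficients with [x] fixed. *)
Lemma chebyshev_count (R : realFieldType) (I T : finType) (h : I -> T -> R)
    (v delta : R) :
  (0 < #|T|)%N -> 0 <= delta ->
  (forall i, \sum_t h i t = 0) ->
  (forall i, \sum_t h i t ^+ 2 <= v * #|T|%:R) ->
  #|[set x : {ffun I -> T} | delta <= `|\sum_i h i (x i)|]%SET|%:R * delta ^+ 2
  <= #|I|%:R * v * #|{ffun I -> T}|%:R.
Proof.
move=> T0 d0 h0 hv.
have T0' : 0 < #|T|%:R :> R by rewrite ltr0n.
rewrite -(ler_pM2r T0') mulrAC.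
apply: (@le_trans _ _ ((\sum_(x : {ffun I -> T}) (\sum_i h i (x i)) ^+ 2) * #|T|%:R)).
  rewrite mulrAC (ler_pM2r T0') mulrC mulr_natr -sumr_const.
  rewrite big_mkcond /=; apply: ler_sum => x _.
  rewrite inE; case: ifP => hx; last exact: sqr_ge0.
  by rewrite -[leRHS]real_normK ?num_real// lerXn2r ?nnegrE.
rewrite sum_sqr_centered //.
rewrite [leRHS]mulrAC ler_wpM2r ?ler0n //.
apply: le_trans (ler_sum _ (fun i _ => hv i)) _.
by rewrite sumr_const -mulrA mulr_natl.
Qed.

(** * Steering an integer by signs *)

(** Each sign follows the current residue. If the residue is at least [f i] in size, it shrinks by
    [f i]; otherwise it drops to at most [X], and later steps keep it there. *)
Lemma greedy_signs (I : finType) (f : I -> nat) (X : nat) (A : {set I}) :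
  (forall i, i \in A -> (f i <= X)%N) ->
  forall r : int, exists2 c : I -> int, (forall i, c i \in [:: 1; -1]) &
    `|r - \sum_(i in A) (f i)%:Z * c i| <= X%:Z \/
    `|r - \sum_(i in A) (f i)%:Z * c i| <= `|r| - \sum_(i in A) (f i)%:Z.
Proof.
have [n] := ubnP #|A|; elim: n A => // n IH A + fX r.
have [->|[i iA]] := set_0Vmem A.
  by exists (fun=> 1) => //; rewrite !big_set0 !subr0; right.
rewrite (cardsD1 i) iA /= add1n ltnS => /IH{}IH.
pose s : int := if 0 <= r then 1 else -1.
have sS : s \in [:: 1; -1] by rewrite /s !inE; case: ifP.
have [j|c cS hc] := IH _ (r - (f i)%:Z * s); first by rewrite !inE => /andP[_ /fX].
exists (fun j => if j == i then s else c j) => [j|]; first by case: ifP.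
rewrite !(big_setD1 i iA) /= eqxx.
rewrite (eq_bigr (fun j => (f j)%:Z * c j)); last first.
  by move=> j; rewrite !inE => /andP[/negPf ->].
set S := \sum_(_ in _) _ in hc *; set S' := \sum_(j in A :\ i) _ in hc *.
have S0 : 0 <= S' by apply: sumr_ge0.
have := fX _ iA; rewrite /s in hc *.
by case: ifP hc => r0 hc fiX; lia.
Qed.

(* Large entries first bring the residue below the threshold; the small ones
   then carry enough mass to bring it below their common bound. *)
Lemma signed_sum_approx (I : finType) (f : I -> nat) (X E T : nat) (r : int) :
  (forall i, (f i <= X)%N) -> (X <= T)%N ->
  (T <= \sum_(i | (f i <= E)%N) f i)%N -> `|r| <= T%:Z ->
  exists2 c : I -> int, (forall i, c i \in [:: 1; -1]) &
    `|r - \sum_i (f i)%:Z * c i| <= E%:Z.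
Proof.
move=> fX XT Tf rT.
have [//|c1 c1S h1] := @greedy_signs I f X [set i | (E < f i)%N]%SET _ r.
set r1 := r - _ in h1.
have r1T : `|r1| <= T%:Z.
  case: h1 => [|/le_trans]; first by move/le_trans; apply; rewrite lez_nat.
  by apply; apply: le_trans rT; rewrite gerBl; apply: sumr_ge0.
have [i|c2 c2S h2] := @greedy_signs I f E [set i | (f i <= E)%N]%SET _ r1.
  by rewrite inE.
exists (fun i => if (f i <= E)%N then c2 i else c1 i) => [i|]; first by case: ifP.
rewrite (bigID (fun i => (f i <= E)%N)) /=.
rewrite (eq_bigr (fun i => (f i)%:Z * c2 i)); last by move=> i ->.
rewrite [X in _ - (_ + X)](eq_bigr (fun i => (f i)%:Z * c1 i)); last first.
  by move=> i /negPf ->.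
have -> : \sum_(i | ~~ (f i <= E)%N) (f i)%:Z * c1 i
    = \sum_(i in [set i | (E < f i)%N]%SET) (f i)%:Z * c1 i.
  by apply: eq_bigl => i; rewrite inE ltnNge.
have eE (F : I -> int) : \sum_(i in [set i | (f i <= E)%N]%SET) F i
    = \sum_(i | (f i <= E)%N) F i by apply: eq_bigl => i; rewrite inE.
rewrite !eE in h2.
have -> : r - (\sum_(i | (f i <= E)%N) (f i)%:Z * c2 i +
   \sum_(i in [set i | (E < f i)%N]%SET) (f i)%:Z * c1 i)
   = r1 - \sum_(i | (f i <= E)%N) (f i)%:Z * c2 i by rewrite /r1; ring.
case: h2 => // h2; apply: le_trans h2 _.
apply: (@le_trans _ _ 0) => //.
rewrite subr_le0; apply: le_trans r1T _.
by rewrite -(big_morph Posz PoszD (erefl _)) lez_nat.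
Qed.

Lemma double_sum_ord (E : nat) : ((\sum_(i < E.+1) i) * 2 = E * E.+1)%N.
Proof.
elim: E => [|E IH]; rewrite big_ord_recr /= ?big_ord0 // mulnDl IH.
by rewrite (mulnC E) -mulnDr addn2.
Qed.

(** An entry truncated to zero above [E] has mean [mu = E(E+1)/(2M)], and the hypothesis says that
    [T] is at most half of [m * mu]. Since [f t ^ 2 <= E * f t], the variance is at most [E * mu],
    and Chebyshev with deviation [m * mu / 2] gives the bound. *)
Lemma small_mass_count (R : realFieldType) (m M E T : nat) :
  (0 < E < M)%N -> (0 < T)%N -> (4 * T * M <= m * (E * E.+1))%N ->
  #|[set x : {ffun 'I_m -> 'I_M} |
      (\sum_(i | (x i <= E)%N) (x i : nat) < T)%N]%SET|%:R
  <= 8 * M%:R / (m%:R * E.+1%:R) * M%:R ^+ m :> R.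
Proof.
move=> /andP[E0 EM] T0 hT.
have m0 : (0 < m)%N by case: m hT => //; rewrite mul0n; nia.
have M0 : (0 < M)%N by exact: leq_ltn_trans EM.
pose f (t : 'I_M) : R := if (t <= E)%N then (t : nat)%:R else 0.
pose s : R := E%:R * E.+1%:R / 2.
have fs : \sum_t f t = s.
  rewrite -big_mkcond /= -natr_sum.
  rewrite -(big_ord_widen M (fun i => i) EM).
  by apply: (@mulIf _ 2); rewrite ?mulfVK // -!natrM double_sum_ord.
have [mu muE] : exists mu : R, mu = s / M%:R by exists (s / M%:R).
have E0R : 0 < E%:R :> R by rewrite ltr0n.
have M0R : 0 < M%:R :> R by rewrite ltr0n.
have m0R : 0 < m%:R :> R by rewrite ltr0n.
have E1R : 0 < E.+1%:R :> R by rewrite ltr0n.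
have s0 : 0 < s by rewrite /s divr_gt0 ?mulr_gt0.
have mu0 : 0 < mu by rewrite muE divr_gt0.
have hT' : 2 * T%:R <= m%:R * mu.
  rewrite muE /s mulrA ler_pdivlMr // mulrA ler_pdivlMr //.
  by rewrite -!natrM ler_nat; nia.
have := @chebyshev_count R 'I_m 'I_M (fun _ t => f t - mu) (E%:R * mu) (m%:R * mu / 2).
rewrite !card_ord card_ffun !card_ord => /(_ M0).
have -> : 0 <= m%:R * mu / 2 by rewrite divr_ge0 ?mulr_ge0 // ltW.
have muM : mu * M%:R = s by rewrite muE mulfVK // gt_eqF.
have sum0 : \sum_t (f t - mu) = 0.
  by rewrite sumrB sumr_const card_ord fs -[mu *+ M]mulr_natr muM subrr.
move=> /(_ isT (fun=> sum0)).
have var : \sum_t (f t - mu) ^+ 2 <= E%:R * mu * M%:R.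
  apply: (@le_trans _ _ (\sum_t (E%:R * f t - 2 * mu * f t + mu ^+ 2))).
    apply: ler_sum => t _; rewrite sqrrB.
    have : f t ^+ 2 <= E%:R * f t.
      rewrite /f; case: ifP => tE; last by rewrite mulr0 expr0n.
      by rewrite expr2 ler_wpM2r // ler_nat.
    lra.
  rewrite big_split /= sumrB -!mulr_sumr fs sumr_const card_ord.
  rewrite -[mu *+ M]mulr_natr -[E%:R * mu * _]mulrA muM.
  by have := mulr_gt0 mu0 s0; lra.
move=> /(_ (fun=> var)) cheb.
set A := [set x : {ffun 'I_m -> 'I_M} | _]%SET.
have {}cheb : #|A|%:R * (m%:R * mu / 2) ^+ 2 <= m%:R * (E%:R * mu) * M%:R ^+ m.
  rewrite natrX in cheb; apply: le_trans cheb.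
  rewrite ler_wpM2r ?sqr_ge0 // ler_nat; apply: subset_leq_card.
  apply/fintype.subsetP => x; rewrite !inE sumrB sumr_const card_ord -[mu *+ m]mulr_natr => hx.
  have : \sum_i f (x i) < T%:R.
    by rewrite -big_mkcond -natr_sum ltr_nat.
  by move=> hf; rewrite distrC; apply: le_trans (ler_norm _); lra.
have dpos : 0 < (m%:R * mu / 2) ^+ 2 by rewrite exprn_gt0 // divr_gt0 ?mulr_gt0.
rewrite -ler_pdivlMr // in cheb; apply: le_trans cheb _.
rewrite le_eqVlt; apply/orP; left; apply/eqP; rewrite muE /s.
by field; rewrite !gt_eqF.
Qed.

(** * Counting solutions of one and of two linear equations *)

(** Coefficients are elements of an abstract finite type [K] with values [g]; later [K] is C and [g]
    its inclusion [fsval] into the integers. *)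
Definition sdot (I K : finType) (M : nat) (g : K -> int)
    (x : {ffun I -> 'I_M}) (c : {ffun I -> K}) : int :=
  \sum_i (x i : nat)%:Z * g (c i).

Lemma sdot_upd (I K : finType) (M : nat) (g : K -> int)
    (x : {ffun I -> 'I_M}) (c : {ffun I -> K}) j z :
  sdot g (upd x j z) c
  = (z : nat)%:Z * g (c j) + \sum_(i | i != j) (x i : nat)%:Z * g (c i).
Proof.
rewrite /sdot (bigD1 j) //= upd_same; congr (_ + _).
by apply: eq_bigr => i ij; rewrite upd_other.
Qed.

Lemma card_set_pair (S T : finType) (P : S -> T -> bool) :
  #|[set p : S * T | P p.1 p.2]%SET| = (\sum_s #|[set t | P s t]%SET|)%N.
Proof.
rewrite -sum1dep_card -(pair_big_dep predT P (fun _ _ => 1%N)) /=.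
by apply: eq_bigr => s _; rewrite sum1dep_card.
Qed.

(** Once the targets are fixed, subtracting the equations determines [z] since the slopes differ,
    and then [y]. This crude count serves the exceptional pairs of coefficient vectors; [s] and [s']
    collect the other coordinates. *)
Lemma card_two_equations (U : finType) (M : nat) (w : U -> int)
    (s s' a a' : int) :
  a != a' ->
  (#|[set p : 'I_M * ('I_M * (U * U)) |
      ((p.2.1 : nat)%:Z + ((p.1 : nat)%:Z * a + s) == w p.2.2.1)%R &&
      ((p.2.1 : nat)%:Z + ((p.1 : nat)%:Z * a' + s') == w p.2.2.2)%R]%SET|
   <= #|U| ^ 2)%N.
Proof.
move=> aa'; rewrite -mulnn -card_prod.
apply: (@leq_card_in _ _ (fun p => p.2.2)).
case=> [z [y [u u']]] [z1 [y1 [v v']]]; rewrite !inE /=.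
move=> /andP[/eqP h1 /eqP h2] /andP[/eqP h3 /eqP h4] [uv uv'].
rewrite -{}uv -{}uv' in h3 h4 *.
have : ((z : nat)%:Z - (z1 : nat)%:Z) * (a - a') = 0 by lia.
move/eqP; rewrite mulf_eq0 !subr_eq0 (negPf aa') orbF => /eqP zz.
have yy : (y : nat)%:Z = (y1 : nat)%:Z by rewrite zz in h1; lia.
by congr (_, (_, _)); apply: val_inj; [case: zz|case: yy].
Qed.

(* Replacing w by the exact values u - W moves the unique solution (y, z) by at
   most 3E in each coordinate, and the moved solution determines u and u'. *)
Lemma card_unimodular_equations (M E W : nat) (w : 'I_(2 * W).+1 -> int)
    (s s' : int) :
  (0 < M)%N ->
  (forall u, `|w u - ((u : nat)%:Z - W%:Z)| <= E%:Z) ->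
  (#|[set p : 'I_M * ('I_M * ('I_(2 * W).+1 * 'I_(2 * W).+1)) |
      ((p.2.1 : nat)%:Z + ((p.1 : nat)%:Z * 1 + s) == w p.2.2.1)%R &&
      ((p.2.1 : nat)%:Z + ((p.1 : nat)%:Z * 2 + s') == w p.2.2.2)%R]%SET|
   <= (M + 6 * E) ^ 2)%N.
Proof.
move=> M0 hw.
pose V := (M + 6 * E).-1.
have -> : ((M + 6 * E) ^ 2 = #|{: 'I_V.+1 * 'I_V.+1}|)%N.
  by rewrite card_prod !card_ord mulnn /V prednK // addn_gt0 M0.
pose z0 (u u' : 'I_(2 * W).+1) : int := (u' : nat)%:Z - (u : nat)%:Z + s - s'.
pose y0 (u u' : 'I_(2 * W).+1) : int := (u : nat)%:Z - W%:Z - s - z0 u u'.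
pose F (p : 'I_M * ('I_M * ('I_(2 * W).+1 * 'I_(2 * W).+1))) : 'I_V.+1 * 'I_V.+1 :=
  (inord (absz (z0 p.2.2.1 p.2.2.2 + (3 * E)%:Z)),
   inord (absz (y0 p.2.2.1 p.2.2.2 + (3 * E)%:Z))).
have VE : (V.+1 = M + 6 * E)%N by rewrite /V prednK // addn_gt0 M0.
apply: (@leq_card_in _ _ F).
have key z y u u' : (y : nat)%:Z + ((z : nat)%:Z * 1 + s) = w u ->
    (y : nat)%:Z + ((z : nat)%:Z * 2 + s') = w u' -> (z < M)%N -> (y < M)%N ->
    [/\ 0 <= z0 u u' + (3 * E)%:Z, z0 u u' + (3 * E)%:Z < V.+1%:Z,
        0 <= y0 u u' + (3 * E)%:Z & y0 u u' + (3 * E)%:Z < V.+1%:Z].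
  move=> h1 h2 zM yM; have := hw u; have := hw u'.
  by rewrite /y0 /z0 -h1 -h2 VE => hu hu'; split; lia.
case=> [z [y [u u']]] [z1 [y1 [v v']]]; rewrite !inE /=.
move=> /andP[/eqP h1 /eqP h2] /andP[/eqP h3 /eqP h4].
have [a1 a2 a3 a4] := key _ _ _ _ h1 h2 (ltn_ord z) (ltn_ord y).
have [b1 b2 b3 b4] := key _ _ _ _ h3 h4 (ltn_ord z1) (ltn_ord y1).
case=> /(congr1 (@nat_of_ord _)) + /(congr1 (@nat_of_ord _)) /=.
rewrite !inordK; try lia.
move=> e1 e2.
have ez : z0 u u' = z0 v v' by lia.
have ey : y0 u u' = y0 v v' by lia.
have eu : u = v by apply: val_inj => /=; move: ez ey; rewrite /y0 /z0; lia.
have eu' : u' = v' by apply: val_inj => /=; move: ez ey; rewrite /y0 /z0; lia.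
rewrite -{}eu -{}eu' in h3 h4 *.
congr (_, (_, _)); apply: val_inj => /=; lia.
Qed.

(** For each integer [v] with [t + E <= v < t + M - E], the target indexed by [v] is within [E] of
    [v], hence exceeds [t] by an admissible [y] in [[0, M)]. The bound on [t] keeps [v] in
    [[-W, W]]. *)
Lemma card_near_window (M E W : nat) (w : 'I_(2 * W).+1 -> int) (t : int) :
  (2 * E <= M)%N ->
  (forall u, `|w u - ((u : nat)%:Z - W%:Z)| <= E%:Z) ->
  `|t| + M%:Z <= W%:Z ->
  (M - 2 * E <= #|[set p : 'I_M * 'I_(2 * W).+1 | ((p.1 : nat)%:Z + t == w p.2)%R]%SET|)%N.
Proof.
move=> EM hw tW.
have [->|M0] := posnP (M - 2 * E); first by [].
have M1 : (0 < M)%N by lia.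
pose u (i : 'I_(M - 2 * E)) : 'I_(2 * W).+1 :=
  inord (absz (t + E%:Z + (i : nat)%:Z + W%:Z)).
have uE i : (u i : nat)%:Z = t + E%:Z + (i : nat)%:Z + W%:Z.
  by have li := ltn_ord i; rewrite /u inordK; lia.
(* The difference always lies in [[0, M)], so the default [Ordinal M1] is never taken. *)
pose y i : 'I_M := insubd (Ordinal M1) (absz (w (u i) - t)).
have yE i : (y i : nat)%:Z = w (u i) - t.
  have := hw (u i); rewrite uE => h.
  have li := ltn_ord i.
  rewrite /y val_insubd ifT; lia.
rewrite -{1}[(M - 2 * E)%N]card_ord.
rewrite -(@card_imset _ _ (fun i => (y i, u i))) /=; last first.
  move=> i j [_ /(congr1 (fun v : 'I__ => (v : nat)%:Z))]; rewrite !uE => h.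
  by apply: val_inj => /=; lia.
apply: subset_leq_card; apply/fintype.subsetP => p /imsetP[i _ ->].
by rewrite inE /= yE subrK.
Qed.

(** Such a pair is a word of length [b] over [K * K] that avoids the letter [(k1, k2)]. *)
Lemma card_no_coincidence (b : nat) (K : finType) (k1 k2 : K) :
  (\sum_(c : {ffun 'I_b -> K}) \sum_(c' : {ffun 'I_b -> K})
     ~~ [exists j, (c j == k1) && (c' j == k2)] <= (#|K| ^ 2 - 1) ^ b)%N.
Proof.
rewrite pair_big /= -big_mkcond /= sum1_card.
have -> : ((#|K| ^ 2 - 1) ^ b = #|ffun_on (predC1 (k1, k2)) : {pred {ffun 'I_b -> K * K}}|)%N.
  by rewrite card_ffun_on card_ord cardC1 card_prod mulnn subn1.
pose F (p : {ffun 'I_b -> K} * {ffun 'I_b -> K}) : {ffun 'I_b -> K * K} :=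
  [ffun j => (p.1 j, p.2 j)].
have Finj : injective F.
  move=> [c c'] [e e'] /ffunP h; congr pair; apply/ffunP => j;
  by have := h j; rewrite !ffunE /= => -[].
rewrite -(card_imset _ Finj); apply: subset_leq_card.
apply/fintype.subsetP => f /imsetP[p hp ->]; apply/ffun_onP => j.
rewrite !inE ffunE xpair_eqE; apply: contraNN hp => h.
by apply/existsP; exists j.
Qed.

Lemma sum_resample_le (R : realFieldType) (I T : finType) (j : I)
    (F : {ffun I -> T} -> R) (B : R) :
  (forall x, \sum_z F (upd x j z) <= B) ->
  #|T|%:R * (\sum_x F x) <= #|{ffun I -> T}|%:R * B.
Proof.
move=> hF; rewrite mulr_natl -(sum_resample j).
apply: le_trans (ler_sum _ (fun x _ => hF x)) _.
by rewrite sumr_const mulr_natl.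
Qed.

(** * First and second moments of the number of hits *)

(** The index [u] encodes the shift [s = u - W], and [w u] is the target [w_s]. The steering block
    enters only through [w]. *)
Definition hits (b M W : nat) (K : finType) (g : K -> int)
    (w : 'I_(2 * W).+1 -> int) (x : {ffun 'I_b -> 'I_M})
    (c : {ffun 'I_b -> K}) (y : 'I_M) (u : 'I_(2 * W).+1) : bool :=
  (y : nat)%:Z + sdot g x c == w u.

(** Both hits share the same [y], so summing over [c] and [c'] gives the sum over [y] of the squared
    number of hits. *)
Definition pair_hits (R : realFieldType) (b M W : nat) (K : finType)
    (g : K -> int) (w : 'I_(2 * W).+1 -> int) (c c' : {ffun 'I_b -> K})
    (x : {ffun 'I_b -> 'I_M}) : R :=
  #|[set q : 'I_M * ('I_(2 * W).+1 * 'I_(2 * W).+1) |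
     hits g w x c q.1 q.2.1 && hits g w x c' q.1 q.2.2]%SET|%:R.

(** The three terms cover three cases: a coordinate with values 1 and 2 (unimodular count), no such
    coordinate but [c != c'] (crude count), and [c = c']. Adding them gives one formula that can be
    summed over all pairs. *)
Lemma sum_pair_hits (R : realFieldType) (b M E W : nat) (K : finType)
    (g : K -> int) (k1 k2 : K) (w : 'I_(2 * W).+1 -> int)
    (c c' : {ffun 'I_b -> K}) :
  injective g -> g k1 = 1 -> g k2 = 2 -> (0 < M)%N ->
  (forall u, `|w u - ((u : nat)%:Z - W%:Z)| <= E%:Z) ->
  M%:R * (\sum_(x : {ffun 'I_b -> 'I_M}) pair_hits R g w c c' x) <=
  M%:R ^+ b *
    ((M%:R + 6 * E%:R) ^+ 2
     + (2 * W).+1%:R ^+ 2 *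
       (~~ [exists j, (c j == k1) && (c' j == k2)] : nat)%:R
     + M%:R * (2 * W).+1%:R ^+ 2 * (c == c' : nat)%:R).
Proof.
move=> gI gk1 gk2 M0 hw.
set U := 'I_(2 * W).+1.
have pos0 : 0 <= (M%:R + 6 * E%:R : R) ^+ 2 by apply: sqr_ge0.
have pos1 : 0 <= ((2 * W).+1%:R : R) ^+ 2 by apply: sqr_ge0.
(* It suffices to count with [x j] redrawn together with [y], uniformly in the other entries. *)
have resampled j B : (forall x, (#|[set p : 'I_M * ('I_M * (U * U)) |
     hits g w (upd x j p.1) c p.2.1 p.2.2.1 &&
     hits g w (upd x j p.1) c' p.2.1 p.2.2.2]%SET| <= B)%N) ->
   M%:R * (\sum_(x : {ffun 'I_b -> 'I_M}) pair_hits R g w c c' x) <=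
   M%:R ^+ b * B%:R.
  move=> hB; have := @sum_resample_le R 'I_b 'I_M j (pair_hits R g w c c') B%:R.
  rewrite card_ffun !card_ord natrX; apply => x.
  rewrite /pair_hits -natr_sum ler_nat; apply: leq_trans (hB x).
  by rewrite (card_set_pair (fun z (q : 'I_M * (U * U)) =>
    hits g w (upd x j z) c q.1 q.2.1 && hits g w (upd x j z) c' q.1 q.2.2)).
have [<-|cc'] := eqVneq c c'.
  (* On the diagonal [y] is forced by [u], so each [x] contributes at most [(2W+1)^2]. *)
  rewrite mulr1; apply: (@le_trans _ _ (M%:R ^+ b * (M%:R * (2 * W).+1%:R ^+ 2))); last first.
    by rewrite ler_wpM2l ?exprn_ge0 // lerDr addr_ge0 // mulr_ge0.
  rewrite mulrCA ler_wpM2l //.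
  have -> : M%:R ^+ b = #|{ffun 'I_b -> 'I_M}|%:R :> R.
    by rewrite card_ffun !card_ord natrX.
  rewrite mulr_natl -sumr_const; apply: ler_sum => x _.
  rewrite /pair_hits -natrX ler_nat.
  have -> : ((2 * W).+1 ^ 2 = #|{: U * U}|)%N by rewrite card_prod card_ord.
  apply: (@leq_card_in _ _ snd) => -[y [u u']] [z [v v']].
  rewrite !inE /hits /= => /andP[/eqP h1 _] /andP[/eqP h2 _] [uv uv'].
  rewrite -uv -uv'; congr (_, _); apply: val_inj => /=.
  by rewrite -uv -h1 in h2; lia.
rewrite mulr0 addr0.
have [/existsP[j /andP[/eqP cj /eqP cj']]|_] /= :=
  boolP [exists j, (c j == k1) && (c' j == k2)].
  rewrite mulr0 addr0 (_ : M%:R + 6 * E%:R = (M + 6 * E)%:R); last first.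
    by rewrite natrD natrM.
  rewrite -[_%:R ^+ 2]natrX; apply: (resampled j) => x.
  apply: leq_trans (card_unimodular_equations
    (\sum_(i | i != j) (x i : nat)%:Z * g (c i))
    (\sum_(i | i != j) (x i : nat)%:Z * g (c' i)) M0 hw).
  apply: subset_leq_card; apply/fintype.subsetP => p.
  by rewrite !inE /hits !sdot_upd cj cj' gk1 gk2.
rewrite mulr1.
have [j cj] : exists j, c j != c' j.
  apply/existsP; apply: contraNT cc' => /existsPn h; apply/eqP/ffunP => j.
  by have := h j; rewrite negbK => /eqP.
apply: (@le_trans _ _ (M%:R ^+ b * (2 * W).+1%:R ^+ 2)); last first.
  by rewrite ler_wpM2l ?exprn_ge0 // lerDr.
rewrite -[_%:R ^+ 2]natrX; apply: (resampled j) => x.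
have gj : g (c j) != g (c' j) by apply: contraNneq cj => /gI ->.
have := card_two_equations M w
    (\sum_(i | i != j) (x i : nat)%:Z * g (c i))
    (\sum_(i | i != j) (x i : nat)%:Z * g (c' i)) gj.
rewrite card_ord; apply: leq_trans.
apply: subset_leq_card; apply/fintype.subsetP => p.
by rewrite !inE /hits !sdot_upd.
Qed.

Lemma second_moment (R : realFieldType) (b M E W : nat) (K : finType)
    (g : K -> int) (k1 k2 : K) (w : 'I_(2 * W).+1 -> int) :
  injective g -> g k1 = 1 -> g k2 = 2 -> (0 < M)%N ->
  (forall u, `|w u - ((u : nat)%:Z - W%:Z)| <= E%:Z) ->
  M%:R * (\sum_(x : {ffun 'I_b -> 'I_M}) \sum_(y : 'I_M)
    (\sum_c #|[set u | hits g w x c y u]%SET|%:R : R) ^+ 2) <=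
  M%:R ^+ b *
    ((M%:R + 6 * E%:R) ^+ 2 * (#|K|%:R ^+ b) ^+ 2
     + (2 * W).+1%:R ^+ 2 * (#|K|%:R ^+ 2 - 1) ^+ b
     + M%:R * (2 * W).+1%:R ^+ 2 * #|K|%:R ^+ b).
Proof.
move=> gI gk1 gk2 M0 hw.
have -> : \sum_(x : {ffun 'I_b -> 'I_M}) \sum_(y : 'I_M)
    (\sum_c #|[set u | hits g w x c y u]%SET|%:R : R) ^+ 2
  = \sum_c \sum_c' \sum_(x : {ffun 'I_b -> 'I_M}) pair_hits R g w c c' x.
  under eq_bigr => x _.
    under eq_bigr => y _ do rewrite expr2 big_distrlr /=.
    rewrite exchange_big /=.
    under eq_bigr => c _ do rewrite exchange_big /=.
    over.
  rewrite exchange_big /=; apply: eq_bigr => c _.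
  rewrite exchange_big /=; apply: eq_bigr => c' _.
  apply: eq_bigr => x _; rewrite /pair_hits.
  rewrite (card_set_pair (fun y (q : 'I_(2 * W).+1 * 'I_(2 * W).+1) =>
     hits g w x c y q.1 && hits g w x c' y q.2)) natr_sum.
  apply: eq_bigr => y _; rewrite -natrM -cardsX; congr (_%:R).
  by apply: eq_card => q; rewrite !inE.
rewrite mulr_sumr; under eq_bigr do rewrite mulr_sumr.
apply: le_trans (ler_sum _ (fun c _ => ler_sum _ (fun c' _ =>
  sum_pair_hits R c c' gI gk1 gk2 M0 hw))) _.
have := sqr_ge0 ((2 * W).+1%:R : R).
move: (_ ^+ 2) ((_ + _) ^+ 2) => A2 A1 A20.
under eq_bigr do rewrite -mulr_sumr.
rewrite -mulr_sumr ler_wpM2l ?exprn_ge0 //.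
under eq_bigr do rewrite !big_split /= -!mulr_sumr.
rewrite !big_split /= -!mulr_sumr.
apply: lerD; first apply: lerD.
- by rewrite !sumr_const card_ffun card_ord -mulrnA mulnn -[leLHS]mulr_natr !natrX.
- rewrite ler_wpM2l //.
  have K0 : (0 < #|K|)%N by apply/card_gt0P; exists k1.
  rewrite (_ : #|K|%:R ^+ 2 - 1 = (#|K| ^ 2 - 1)%:R); last first.
    by rewrite natrB ?natrX // expn_gt0 K0.
  rewrite -natrX; apply: le_trans (_ : (_ : nat)%:R <= _); last first.
    by rewrite ler_nat; exact: card_no_coincidence k1 k2.
  by rewrite natr_sum; apply: ler_sum => c _; rewrite natr_sum.
- rewrite ler_wpM2l ?mulr_ge0 //.
  rewrite (eq_bigr (fun=> 1)) => [|c _].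
    by rewrite sumr_const card_ffun card_ord natrX.
  rewrite (bigD1 c) //= eqxx big1 ?addr0 // => c' h.
  by rewrite eq_sym (negPf h).
Qed.

(** The bound holds for each fixed [x]. As a function of random [c], [x.c] is centered with variance
    at most [b (M d)^2], so by Chebyshev few [c] have [|x.c| >= W - M]; every other [c] yields at
    least [M - 2E] hits. *)
Lemma first_moment (R : realFieldType) (b M E W d : nat) (K : finType)
    (g : K -> int) (w : 'I_(2 * W).+1 -> int) :
  (0 < #|K|)%N -> \sum_k g k = 0 -> (forall k, `|g k| <= d%:Z) ->
  (2 * E <= M)%N -> (M < W)%N ->
  (forall u, `|w u - ((u : nat)%:Z - W%:Z)| <= E%:Z) ->
  (M%:R - 2 * E%:R) * (M%:R ^+ b * #|K|%:R ^+ b *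
    (1 - b%:R * (M%:R * d%:R) ^+ 2 / (W%:R - M%:R) ^+ 2)) <=
  \sum_(x : {ffun 'I_b -> 'I_M}) \sum_(y : 'I_M)
    (\sum_c #|[set u | hits g w x c y u]%SET|%:R : R).
Proof.
move=> K0 g0 gd EM MW hw.
have D0 : 0 < W%:R - M%:R :> R by rewrite subr_gt0 ltr_nat.
have ME0 : 0 <= M%:R - 2 * E%:R :> R by rewrite subr_ge0 -natrM ler_nat.
have -> : M%:R ^+ b * #|K|%:R ^+ b *
    (1 - b%:R * (M%:R * d%:R) ^+ 2 / (W%:R - M%:R) ^+ 2)
  = \sum_(x : {ffun 'I_b -> 'I_M}) (#|K|%:R ^+ b *
    (1 - b%:R * (M%:R * d%:R) ^+ 2 / (W%:R - M%:R) ^+ 2)) :> R.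
  by rewrite sumr_const card_ffun !card_ord -[RHS]mulr_natl natrX mulrA.
rewrite mulr_sumr; apply: ler_sum => x _.
rewrite exchange_big /=.
pose far := [set c : {ffun 'I_b -> K} |
   W%:R - M%:R <= `|\sum_i (x i : nat)%:R * (g (c i))%:~R : R|]%SET.
have cheb : #|far|%:R * (W%:R - M%:R) ^+ 2 <=
    b%:R * (M%:R * d%:R) ^+ 2 * #|K|%:R ^+ b :> R.
  have := @chebyshev_count R 'I_b K (fun i k => (x i : nat)%:R * (g k)%:~R)
    ((M%:R * d%:R) ^+ 2) (W%:R - M%:R) K0 (ltW D0).
  rewrite card_ffun !card_ord natrX; apply=> i.
    by rewrite -mulr_sumr -rmorph_sum g0 mulr0.
  rewrite mulr_natr -sumr_const; apply: ler_sum => k _.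
  rewrite -real_normK ?num_real// lerXn2r ?nnegrE ?mulr_ge0 //.
  rewrite normrM ler_pM ?normr_ge0 //.
    by rewrite normr_nat ler_nat ltnW.
  by rewrite -intr_norm -[leRHS]/(d%:Z%:~R) ler_int.
have split_c : #|K|%:R ^+ b = #|far|%:R + #|~: far|%:R :> R.
  by rewrite -natrD cardsC card_ffun card_ord natrX.
apply: (@le_trans _ _ ((M%:R - 2 * E%:R) * #|~: far|%:R)).
  rewrite ler_wpM2l // mulrBr mulr1 {1}split_c.
  by rewrite lerBlDl lerD2r mulrC mulrAC ler_pdivlMr ?exprn_gt0.
rewrite mulr_natr -sumr_const [leRHS](bigID (mem (~: far))) /=.
rewrite -[leLHS]addr0; apply: lerD; last first.
  by apply: sumr_ge0 => c _; apply: sumr_ge0.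
apply: ler_sum => c; rewrite !inE -ltNge => hc.
have tW : `|sdot g x c| + M%:Z <= W%:Z.
  rewrite -(ler_int R) intrD -lerBrDr intr_norm -!pmulrn.
  rewrite /sdot rmorph_sum /= ltW //.
  by under eq_bigr do rewrite rmorphM /= -pmulrn.
have := card_near_window EM hw tW.
rewrite (card_set_pair (fun y u => hits g w x c y u)) -natr_sum.
by rewrite -(ler_nat R) natrB // natrM.
Qed.

(** * The second moment method *)

(** With [Z] the number of hits and [mu = N^b], this bounds the mean of [(Z / mu - 1)^2]: the first
    three summands come from the second moment, the rest from the cross term and the constant. *)
Definition miss_rate (R : realFieldType) (N b M E W d : nat) : R :=
  (1 + 6 * (E%:R / M%:R)) ^+ 2
  + ((2 * W).+1%:R / M%:R) ^+ 2 * (1 - (N%:R ^+ 2)^-1) ^+ b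
  + (2 * W).+1%:R ^+ 2 / (M%:R * N%:R ^+ b)
  - 2 * (1 - 2 * (E%:R / M%:R))
      * (1 - b%:R * (M%:R * d%:R) ^+ 2 / (W%:R - M%:R) ^+ 2) + 1.

(** A pair without hits has [Z = 0] and so contributes [mu^2] to the sum of [(Z - mu)^2]. The centre
    [mu = |K|^b] need not be the exact mean. *)
Lemma miss_count (R : realFieldType) (b M E W d : nat) (K : finType)
    (g : K -> int) (k1 k2 : K) (w : 'I_(2 * W).+1 -> int) :
  injective g -> g k1 = 1 -> g k2 = 2 ->
  \sum_k g k = 0 -> (forall k, `|g k| <= d%:Z) ->
  (0 < M)%N -> (2 * E <= M)%N -> (M < W)%N ->
  (forall u, `|w u - ((u : nat)%:Z - W%:Z)| <= E%:Z) ->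
  #|[set p : {ffun 'I_b -> 'I_M} * 'I_M |
      ~~ [exists c, [exists u, hits g w p.1 c p.2 u]]]%SET|%:R
  <= M%:R ^+ b.+1 * miss_rate R #|K| b M E W d.
Proof.
move=> gI gk1 gk2 g0 gd M0 EM MW hw.
have K0 : (0 < #|K|)%N by apply/card_gt0P; exists k1.
have m2 := @second_moment R b M E W K g k1 k2 w gI gk1 gk2 M0 hw.
have m1 := @first_moment R b M E W d K g w K0 g0 gd EM MW hw.
pose Z (x : {ffun 'I_b -> 'I_M}) (y : 'I_M) : R :=
  \sum_c #|[set u | hits g w x c y u]%SET|%:R.
rewrite -/Z in m1 m2.
have MR : 0 < M%:R :> R by rewrite ltr0n.
have NR : 0 < #|K|%:R :> R by rewrite ltr0n.
set mu : R := #|K|%:R ^+ b in m1 m2.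
have mu0 : 0 < mu by rewrite exprn_gt0.
set A := [set p | _]%SET.
have sumZ : \sum_x \sum_y (Z x y - mu) ^+ 2
    = \sum_x \sum_y Z x y ^+ 2 - 2 * mu * (\sum_x \sum_y Z x y)
      + mu ^+ 2 * M%:R ^+ b.+1.
  have -> : mu ^+ 2 * M%:R ^+ b.+1
      = \sum_(x : {ffun 'I_b -> 'I_M}) \sum_(y : 'I_M) mu ^+ 2.
    by rewrite !sumr_const card_ffun !card_ord -mulrnA -expnS -natrX mulr_natr.
  rewrite mulr_sumr -sumrB -big_split; apply: eq_bigr => x _ /=.
  rewrite mulr_sumr -sumrB -big_split; apply: eq_bigr => y _ /=.
  by rewrite sqrrB; ring.
have cardA : #|A|%:R * mu ^+ 2 <= \sum_x \sum_y (Z x y - mu) ^+ 2.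
  rewrite mulr_natl -sumr_const pair_big /= big_mkcond /=.
  apply: ler_sum => -[x y] _; rewrite inE /=.
  case: ifP => [/existsPn h|_]; last exact: sqr_ge0.
  rewrite /Z big1 ?sub0r ?sqrrN // => c _.
  have /existsPn hc := h c.
  rewrite (_ : [set u | _]%SET = finset.set0) ?cards0 //.
  by apply/setP => u; rewrite !inE; apply/negbTE/hc.
rewrite {}sumZ in cardA.
have mu20 : 0 < M%:R * mu ^+ 2 by rewrite mulr_gt0 ?exprn_gt0.
rewrite -(ler_pM2r mu20).
apply: (@le_trans _ _ (M%:R * (#|A|%:R * mu ^+ 2))); first by rewrite mulrCA.
apply: (le_trans (ler_wpM2l (ltW MR) cardA)).
have K2 : #|K|%:R ^+ 2 != 0 :> R by rewrite expf_neq0 // gt_eqF.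
have -> : M%:R ^+ b.+1 * miss_rate R #|K| b M E W d * (M%:R * mu ^+ 2)
  = M%:R ^+ b *
    ((M%:R + 6 * E%:R) ^+ 2 * mu ^+ 2 +
    (2 * W).+1%:R ^+ 2 * (#|K|%:R ^+ 2 - 1) ^+ b +
    M%:R * (2 * W).+1%:R ^+ 2 * mu)
   - 2 * mu * M%:R * ((M%:R - 2 * E%:R) *
     (M%:R ^+ b * mu * (1 - b%:R * (M%:R * d%:R) ^+ 2 / (W%:R - M%:R) ^+ 2)))
   + M%:R * (mu ^+ 2 * M%:R ^+ b.+1).
  have -> : (#|K|%:R ^+ 2 - 1) ^+ b = (1 - (#|K|%:R ^+ 2)^-1) ^+ b * mu ^+ 2 :> R.
    rewrite /mu -exprM mulnC exprM -exprMn mulrBl mul1r mulVf //.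
  rewrite /miss_rate exprS -/mu.
  move: ((1 - _^-1) ^+ b) (1 - b%:R * _ / _) (M%:R ^+ b) => q t p.
  by field; rewrite !gt_eqF.
have := ler_wpM2l (ltW (mulr_gt0 (mulr_gt0 (ltr0Sn R 1) mu0) MR)) m1.
by move: m2; rewrite mulrDr mulrBr; lra.
Qed.

(** The rate bounds a cardinality, as the exact targets [w_s = s] show. This allows the bad steering
    blocks to be added back to the sum of the rate over good ones. *)
Lemma miss_rate_ge0 (R : realFieldType) (b M E W d : nat) (K : finType)
    (g : K -> int) (k1 k2 : K) :
  injective g -> g k1 = 1 -> g k2 = 2 ->
  \sum_k g k = 0 -> (forall k, `|g k| <= d%:Z) ->
  (0 < M)%N -> (2 * E <= M)%N -> (M < W)%N ->
  0 <= miss_rate R #|K| b M E W d.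
Proof.
move=> gI gk1 gk2 g0 gd M0 EM MW.
have hw (u : 'I_(2 * W).+1) :
    `|((u : nat)%:Z - W%:Z) - ((u : nat)%:Z - W%:Z)| <= E%:Z.
  by rewrite subrr normr0.
have := @miss_count R b M E W d K g k1 k2 _ gI gk1 gk2 g0 gd M0 EM MW hw.
move/(le_trans (ler0n _ _)).
by rewrite pmulr_rge0 // exprn_gt0 // ltr0n.
Qed.

(** * Combining the steering block with the second moment bound *)

(** If [x] is unsolvable, either [x_B] has too little mass in entries at most [E], or it steers and
    [(x_A, y)] misses all targets. The bound on [|tau| + W] puts every [tau - s] within steering
    range [T]. *)
Lemma unsolvable_count (R : realFieldType) (n b m M E T W d : nat)
    (C : {fset int}) (tau : int) :
  n = (1 + b + m)%N ->
  1 \in C -> -1 \in C -> 2 \in C ->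
  \sum_(k : C) fsval k = 0 -> (forall k : C, `|fsval k| <= d%:Z) ->
  (0 < E)%N -> (2 * E <= M)%N -> (M < W)%N -> `|tau| + W%:Z <= T%:Z ->
  (4 * T * M <= m * (E * E.+1))%N ->
  #|~: solvable_instances n M C tau|%:R <=
  M%:R ^+ n * (miss_rate R #|` C| b M E W d + 8 * M%:R / (m%:R * E.+1%:R)) :> R.
Proof.
move=> -> {n} C1 Cm C2 C0 Cd E0 EM MW tT hT.
pose k1 : C := [` C1]%fset; pose k2 : C := [` C2]%fset.
pose km : C := [` Cm]%fset.
have M0 : (0 < M)%N by lia.
pose P (xB : {ffun 'I_m -> 'I_M}) (q : {ffun 'I_b -> 'I_M} * 'I_M) :=
  ~~ [exists cB : {ffun 'I_m -> C}, [exists c : {ffun 'I_b -> C},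
     (q.2 : nat)%:Z + sdot (@fsval _ C) q.1 c + sdot (@fsval _ C) xB cB == tau]].
pose F (x : {ffun 'I_(1 + b + m) -> 'I_M}) :=
  ([ffun j => x (rshift (1 + b) j)],
   ([ffun i => x (lshift m (rshift 1 i))], x (lshift m (lshift b ord0)))).
have Finj : injective F.
  move=> x x' [/ffunP hB /ffunP hA h0]; apply/ffunP => i.
  rewrite -(splitK i); case: (fintype.split i) => [i'|j] /=; last first.
    by have := hB j; rewrite !ffunE.
  rewrite -(splitK i'); case: (fintype.split i') => [k|j] /=; last first.
    by have := hA j; rewrite !ffunE.
  by rewrite (ord1 k).
have badP x : x \notin solvable_instances (1 + b + m) M C tau ->
    P (F x).1 (F x).2.
  apply: contraNN => /existsP[cB /existsP[c /eqP h]].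
  rewrite inE; apply/existsP.
  (* The single entry [y] receives coefficient 1, and the blocks receive [c] and [cB]. *)
  exists [ffun i => match fintype.split i with
    | inl i' => match fintype.split i' with inl _ => k1 | inr k => c k end
    | inr j => cB j end].
  rewrite -h /sdot !big_split_ord big_ord1 /= !ffunE.
  rewrite -[lshift m (lshift b ord0)]/(unsplit (inl (unsplit (inl ord0)))) !unsplitK /= mulr1.
  apply/eqP; congr (_ + _ + _); apply: eq_bigr => i _; rewrite !ffunE.
    by rewrite -[lshift m _]/(unsplit (inl (unsplit (inr i)))) !unsplitK.
  by rewrite -[rshift _ _]/(unsplit (inr i)) !unsplitK.
apply: (@le_trans _ _ (#|[set p | P p.1 p.2]%SET|%:R)).
  rewrite ler_nat -(card_imset _ Finj); apply: subset_leq_card.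
  apply/fintype.subsetP => p /imsetP[x]; rewrite !inE => xS ->.
  by apply: badP; rewrite inE.
rewrite card_set_pair natr_sum.
pose small := [set xB : {ffun 'I_m -> 'I_M} |
   (\sum_(i | (xB i <= E)%N) (xB i : nat) < T)%N]%SET.
have smallB : #|small|%:R <= 8 * M%:R / (m%:R * E.+1%:R) * M%:R ^+ m :> R.
  by apply: small_mass_count => //; lia.
have rate0 := @miss_rate_ge0 R b M E W d C _ k1 k2 val_inj (erefl _) (erefl _)
  C0 Cd M0 EM MW.
rewrite (bigID (mem small)) /= exprD mulrDr addrC.
have Mb : M%:R ^+ (1 + b) = #|{: {ffun 'I_b -> 'I_M} * 'I_M}|%:R :> R.
  by rewrite card_prod card_ffun !card_ord natrM natrX mulrC -exprS.
apply: lerD; last first.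
  (* A block [x_B] of small mass is charged all [M^(b+1)] choices of the remaining entries. *)
  rewrite -mulrA [X in _ <= _ * X]mulrC.
  apply: le_trans (ler_wpM2l (exprn_ge0 _ (ler0n _ _)) smallB).
  rewrite Mb [leRHS]mulr_natr -sumr_const; apply: ler_sum => xB _.
  by rewrite ler_nat max_card.
apply: (@le_trans _ _ (\sum_(xB : {ffun 'I_m -> 'I_M})
    M%:R ^+ (1 + b) * miss_rate R #|` C| b M E W d)); last first.
  by rewrite sumr_const card_ffun !card_ord -[leLHS]mulr_natr natrX mulrAC.
rewrite big_mkcond /=; apply: ler_sum => xB _.
case: ifP => [|_]; last by rewrite mulr_ge0 ?exprn_ge0 // cardfE.
rewrite inE -leqNgt => mass.
have steer (u : 'I_(2 * W).+1) : exists cB : {ffun 'I_m -> C},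
    `|tau - sdot (@fsval _ C) xB cB - ((u : nat)%:Z - W%:Z)| <= E%:Z.
  have [i|||c cS hc] := @signed_sum_approx 'I_m (fun i => xB i) M E T
     (tau - ((u : nat)%:Z - W%:Z)) _ _ mass.
  - exact: ltnW.
  - lia.
  - have := ltn_ord u; lia.
  exists [ffun i => if c i == 1 then k1 else km].
  rewrite addrAC; move: hc; congr (`|_ - _| <= _); apply: eq_bigr => i _.
  rewrite ffunE; have := cS i; rewrite !inE => /orP[/eqP -> //|/eqP ->].
  by [].
have [cB hcB] := fin_all_exists steer.
apply: le_trans (_ : _ <= #|[set p : {ffun 'I_b -> 'I_M} * 'I_M |
  ~~ [exists c, [exists u, hits (@fsval _ C)
       (fun u => tau - sdot (@fsval _ C) xB (cB u)) p.1 c p.2 u]]]%SET|%:R) _; last first.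
  rewrite cardfE.
  exact: (@miss_count R b M E W d C _ k1 k2 _ val_inj (erefl _) (erefl _)).
rewrite ler_nat; apply: subset_leq_card; apply/fintype.subsetP => p.
rewrite !inE; apply: contraNN => /existsP[c /existsP[u /eqP h]].
apply/existsP; exists (cB u); apply/existsP; exists c.
by rewrite h subrK.
Qed.

(** * The coefficient set, and the union bound *)

Lemma mem_coefs (d : nat) (x : int) : (x \in coefs d) = (0 < `|x| <= d)%N.
Proof.
apply/idP/idP.
  rewrite in_fsetU => /orP[] /imfsetP[k /=]; rewrite mem_iota => hk -> /=; lia.
move=> hx; rewrite in_fsetU; apply/orP.
have hm : absz x \in iota 1 d by rewrite mem_iota; lia.
have [x0|x0] := lerP 0 x; [left|right]; apply/imfsetP; exists (absz x) => //=; lia.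
Qed.

Lemma sum_coefs (d : nat) : \sum_(k : coefs d) fsval k = 0.
Proof.
have oppC (k : coefs d) : - fsval k \in coefs d.
  by have := fsvalP k; rewrite !mem_coefs abszN.
pose h (k : coefs d) : coefs d := [` oppC k]%fset.
have hK : involutive h by move=> k; apply: val_inj; rewrite /= opprK.
have : \sum_(k : coefs d) fsval k = - \sum_(k : coefs d) fsval k.
  by rewrite [LHS](reindex_inj (inv_inj hK)) /= sumrN.
lia.
Qed.

Lemma card_coefs_gt1 (d : nat) : (1 < d)%N -> (1 < #|` coefs d|)%N.
Proof.
move=> hd; have C1 : 1 \in coefs d by rewrite mem_coefs; lia.
have Cm : -1 \in coefs d by rewrite mem_coefs; lia.
rewrite cardfE; apply/card_gt1P.
by exists [` C1]%fset, [` Cm]%fset; split => //; rewrite -val_eqE.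
Qed.

(** For each [c], redrawing entry 0 leaves at most one good value among [M], its coefficient being
    nonzero; [0 < n] provides that entry. *)
Lemma solvable_count_le (R : realFieldType) (n M : nat) (C : {fset int})
    (tau : int) :
  (0 < n)%N -> 0 \notin C ->
  M%:R * #|solvable_instances n M C tau|%:R <= #|` C|%:R ^+ n * M%:R ^+ n :> R.
Proof.
case: n => // n _ C0.
pose F (c : {ffun 'I_n.+1 -> C}) (x : {ffun 'I_n.+1 -> 'I_M}) : R :=
  (sdot (@fsval _ C) x c == tau : nat)%:R.
apply: (@le_trans _ _ (M%:R * \sum_x \sum_c F c x)).
  rewrite ler_wpM2l // -sumr_const big_mkcond /=; apply: ler_sum => x _.
  rewrite inE; case: ifP => [/existsP[c hc]|_]; last exact: sumr_ge0.
  rewrite (bigD1 c) //= {1}/F /sdot hc lerDl; exact: sumr_ge0.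
rewrite exchange_big mulr_sumr /=.
have hF c : M%:R * \sum_x F c x <= M%:R ^+ n.+1.
  have := @sum_resample_le R 'I_n.+1 'I_M ord0 (F c) 1.
  rewrite card_ffun !card_ord natrX mulr1; apply => x.
  rewrite /F -natr_sum -[leRHS]/(1%:R) ler_nat -big_mkcond /= sum1dep_card.
  apply/card_le1_eqP => z z'; rewrite !inE !sdot_upd => /eqP h /eqP h'.
  have c0 : fsval (c ord0) != 0 by apply: contraNneq C0 => <-; exact: fsvalP.
  have /eqP : ((z : nat)%:Z - (z' : nat)%:Z) * fsval (c ord0) = 0.
    by rewrite mulrBl (addIr _ (etrans h (esym h'))) subrr.
  rewrite mulf_eq0 (negPf c0) orbF subr_eq0 => /eqP[zz].
  exact: val_inj.
apply: le_trans (ler_sum _ (fun c _ => hF c)) _.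
by rewrite sumr_const card_ffun card_ord -cardfE -[leLHS]mulr_natl natrX.
Qed.

(** * Choice of parameters and estimates of the error terms *)

(** The cubic Taylor term gives [expR (c * x) >= (c * x)^3 / 6]. Thus the factor of order [n^2] from
    the squared window costs only O(1/n) against exponential decay. *)
Lemma sqr_mul_expRN_le (R : realType) (c x : R) : 0 < c -> 0 < x ->
  x ^+ 2 * expR (- (c * x)) <= 6 / c ^+ 3 / x.
Proof.
move=> c0 x0; have cx0 : 0 < c * x by rewrite mulr_gt0.
have := expR_ge1Dxn 2 (ltW cx0); rewrite (_ : 3`! = 6)%N // => h.
rewrite expRN ler_pdivrMr ?expR_gt0 //.
have : (c * x) ^+ 3 / 6 <= expR (c * x) by apply: le_trans h; rewrite lerDr.
have p : 0 <= 6 / c ^+ 3 / x by rewrite !divr_ge0 ?exprn_ge0 ?ltW.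
move=> /(ler_wpM2l p); apply: le_trans.
rewrite le_eqVlt; apply/orP; left; apply/eqP.
by field; rewrite !gt_eqF.
Qed.

(* The constant 32 k^2 k1 makes T at most half of the expected mass
   m E (E + 1) / (2 M) of the entries bounded by E. *)
Lemma parameters_admissible (k k1 n M : nat) (t : nat) :
  (2 <= k)%N -> (2 <= k1)%N -> (2 * (32 * k ^ 2 * k1) <= n)%N -> (k <= M)%N ->
  (t * (32 * k ^ 2 * k1) <= M * n)%N ->
  let m := (n %/ k1)%N in let E := (M %/ k)%N in
  let W := ((n %/ (32 * k ^ 2 * k1)) * M)%N in
  [/\ (0 < E)%N, (2 * E <= M)%N, (M < W)%N &
      (4 * (t + W) * M <= m * (E * E.+1))%N].
Proof.
move=> k2 k12 nK kM tK m E W.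
set K := (32 * k ^ 2 * k1)%N in nK tK W *.
have K0 : (0 < K)%N by rewrite /K !muln_gt0; lia.
have k0 : (0 < k)%N by lia.
have k10 : (0 < k1)%N by lia.
have E0 : (0 < E)%N by rewrite /E divn_gt0.
have kE : (E * k <= M)%N by rewrite /E leq_divM.
have EM : (2 * E <= M)%N by nia.
have q2 : (2 <= n %/ K)%N by rewrite leq_divRL.
have MW : (M < W)%N by rewrite /W; nia.
split => //.
have m0 : (0 < m)%N.
  rewrite /m divn_gt0 //; apply: leq_trans nK; rewrite /K mulnA.
  by rewrite leq_pmull // !muln_gt0 k0.
have hm : (n <= 2 * k1 * m)%N.
  have := ltn_ceil n k10; rewrite -/m; nia.
have hE1 : (M <= E.+1 * k)%N by have := ltn_ceil M k0; rewrite -/E; lia.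
have hE2 : (M <= 2 * (E * k))%N by nia.
have WK : (W * K <= n * M)%N.
  by rewrite /W mulnAC leq_mul2r leq_divM orbT.
rewrite -(leq_pmul2r K0).
(* Both [t * K] and [W * K] are at most [n * M], whence the 8; the factors 2 in [hm] and [hE2] turn
   it into 32. *)
apply: (@leq_trans (8 * (n * (M * M)))); first by nia.
have h := leq_mul hm (leq_mul hE1 hE2).
apply: (leq_trans (leq_mul (leqnn 8) h)).
rewrite /K expnS expn1; apply: eq_leq; ring.
Qed.

(** The constant terms cancel, leaving [16 e + 36 e^2 + 2 th - 4 e th]; as [e <= 1/2], the square
    costs at most [18 e], and 16 + 18 = 34. *)
Lemma rational_part_le (R : realFieldType) (e th k : R) :
  2 <= k -> 0 <= e <= k^-1 -> 0 <= th ->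
  (1 + 6 * e) ^+ 2 - 2 * (1 - 2 * e) * (1 - th) + 1 <= 34 / k + 2 * th.
Proof.
move=> k2 /andP[e0 ek] th0.
have k12 : k^-1 <= 2^-1 by rewrite lef_pV2 ?posrE //; lra.
have : e * e <= 2^-1 * e by rewrite ler_wpM2r //; lra.
have := mulr_ge0 e0 th0.
by rewrite expr2; lra.
Qed.

(** With quotient [q = n %/ K >= 2], [n < (q + 1) K <= 3 (q - 1) K], so [W - M] is at least
    [n M / (3 K)]. *)
Lemma variance_term_le (R : realFieldType) (n b M W K d : nat) :
  (0 < M)%N -> (0 < K)%N -> (2 * K <= n)%N -> (b <= n)%N ->
  W = ((n %/ K) * M)%N ->
  b%:R * (M%:R * d%:R) ^+ 2 / (W%:R - M%:R) ^+ 2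
  <= 9 * K%:R ^+ 2 * d%:R ^+ 2 / n%:R :> R.
Proof.
move=> M0 K0 nK bn WE.
have q2 : (2 <= n %/ K)%N by rewrite leq_divRL.
have h : (n * M <= 3 * K * (W - M))%N.
  have := ltn_ceil n K0; rewrite WE -[X in (_ - X)%N]mul1n -mulnBl mulnA.
  by rewrite leq_mul2r => h; apply/orP; right; nia.
have n0 : 0 < n%:R :> R by rewrite ltr0n; lia.
have MW : (M <= W)%N by rewrite WE; nia.
have MR : 0 < M%:R :> R by rewrite ltr0n.
have KR : 0 < K%:R :> R by rewrite ltr0n.
have {h} : n%:R * M%:R / (3 * K%:R) <= W%:R - M%:R :> R.
  by rewrite ler_pdivrMr ?mulr_gt0 // -natrB // -!natrM ler_nat [leqRHS]mulnC.
set D := W%:R - M%:R => hD.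
have D1 : 0 < n%:R * M%:R / (3 * K%:R) :> R by rewrite divr_gt0 ?mulr_gt0.
have D0 : 0 < D by apply: lt_le_trans hD.
rewrite ler_pdivrMr ?exprn_gt0 //.
apply: (@le_trans _ _ (9 * K%:R ^+ 2 * d%:R ^+ 2 / n%:R * (n%:R * M%:R / (3 * K%:R)) ^+ 2)).
  have -> : 9 * K%:R ^+ 2 * d%:R ^+ 2 / n%:R * (n%:R * M%:R / (3 * K%:R)) ^+ 2
    = n%:R * (M%:R * d%:R) ^+ 2 :> R by field; rewrite !gt_eqF.
  by rewrite ler_wpM2r ?sqr_ge0 // ler_nat.
rewrite ler_wpM2l ?divr_ge0 ?mulr_ge0 ?sqr_ge0 //.
by rewrite lerXn2r ?nnegrE // ltW.
Qed.

(** Here [U] stands for [2W + 1], and [(1 - 1/N^2)^b <= exp(-b/N^2) <= exp(-n/(4 N^2))]. *)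
Lemma window_term_le (R : realType) (n b M U N : nat) :
  (0 < n)%N -> (0 < M)%N -> (1 < N)%N -> (U <= n * M)%N -> (n <= 4 * b)%N ->
  (U%:R / M%:R) ^+ 2 * (1 - (N%:R ^+ 2)^-1) ^+ b
  <= 6 / ((4 * N%:R ^+ 2)^-1) ^+ 3 / n%:R :> R.
Proof.
move=> n0 M0 N1 Un nb.
have MR : 0 < M%:R :> R by rewrite ltr0n.
have NR : 1 < N%:R ^+ 2 :> R by rewrite exprn_egt1 ?ltr1n.
have N0 : 0 < N%:R ^+ 2 :> R by apply: lt_trans NR.
have c0 : 0 < (4 * N%:R ^+ 2)^-1 :> R by rewrite invr_gt0 mulr_gt0.
have nR : 0 < n%:R :> R by rewrite ltr0n.
apply: le_trans (sqr_mul_expRN_le c0 nR).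
have i1 : (N%:R ^+ 2)^-1 < 1 :> R by rewrite invf_lt1.
apply: ler_pM; first exact: sqr_ge0.
- by rewrite exprn_ge0 // subr_ge0 ltW.
- rewrite lerXn2r ?nnegrE ?divr_ge0 //.
  by rewrite ler_pdivrMr // -natrM ler_nat.
apply: (@le_trans _ _ (expR (- (N%:R ^+ 2)^-1) ^+ b)).
  by rewrite lerXn2r ?nnegrE ?expR_ge0 ?expR_ge1Dx // subr_ge0 ltW.
rewrite -expRM_natl ler_expR mulrN lerN2.
rewrite [(4 * _)^-1]invfM mulrAC ler_wpM2r ?invr_ge0 ?sqr_ge0 //.
by rewrite mulrC ler_pdivrMr // mulrC -natrM ler_nat.
Qed.

(** The quotient is at most [n^2 M / N^b]. The bounds on [M] and [b] give
    [M / N^b <= N * N^(-3 eps n / 4)]: the steering block spends only [eps / 4] of the available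
    [eps]. *)
Lemma diagonal_term_le (R : realType) (n b M U N : nat) (eps : R) :
  (0 < n)%N -> (0 < M)%N -> (1 < N)%N -> 0 < eps -> (U <= n * M)%N ->
  n%:R - 1 - eps / 4 * n%:R <= b%:R ->
  M%:R <= N%:R `^ ((1 - eps) * n%:R) ->
  U%:R ^+ 2 / (M%:R * N%:R ^+ b)
  <= N%:R * (6 / (3 / 4 * eps * ln N%:R) ^+ 3) / n%:R :> R.
Proof.
move=> n0 M0 N1 eps0 Un hb hM.
have MR : 0 < M%:R :> R by rewrite ltr0n.
have N0 : 0 < N%:R :> R by rewrite ltr0n; lia.
have L0 : 0 < ln N%:R :> R by rewrite ln_gt0 // ltr1n.
have nR : 0 < n%:R :> R by rewrite ltr0n.
set c := 3 / 4 * eps * ln N%:R.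
have c0 : 0 < c by rewrite /c !mulr_gt0.
rewrite -[leRHS]mulrA.
apply: le_trans (ler_wpM2l (ltW N0) (sqr_mul_expRN_le c0 nR)).
rewrite ler_pdivrMr ?mulr_gt0 ?exprn_gt0 //.
have hU : U%:R ^+ 2 <= n%:R ^+ 2 * M%:R ^+ 2 :> R.
  by rewrite -exprMn lerXn2r ?nnegrE // -natrM ler_nat.
apply: (le_trans hU).
rewrite [M%:R ^+ 2]expr2.
have -> : N%:R * (n%:R ^+ 2 * expR (- (c * n%:R))) * (M%:R * N%:R ^+ b)
  = n%:R ^+ 2 * (M%:R * (N%:R * expR (- (c * n%:R)) * N%:R ^+ b)) :> R by ring.
rewrite ler_wpM2l ?sqr_ge0 // ler_wpM2l //.
apply: (le_trans hM).
have NE : N%:R = expR (ln N%:R) :> R by rewrite lnK.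
rewrite /powR gt_eqF // [X in X * expR _]NE [X in _ * X ^+ b]NE.
rewrite -expRM_natl -!expRD ler_expR /c.
have := ler_wpM2r (ltW L0) hb.
lra.
Qed.

Lemma coefs_unit_two (d : nat) : (1 < d)%N ->
  [/\ 1 \in coefs d, -1 \in coefs d & 2 \in coefs d].
Proof. by move=> d1; rewrite !mem_coefs; split; lia. Qed.

Lemma normz_coefs_le (d : nat) (j : coefs d) : `|fsval j| <= d%:Z.
Proof. by have := fsvalP j; rewrite mem_coefs; lia. Qed.

Lemma parameters_bounds (k k1 n M : nat) :
  (2 <= k)%N -> (2 <= k1)%N -> (2 * (32 * k ^ 2 * k1) <= n)%N ->
  let m := (n %/ k1)%N in let E := (M %/ k)%N in
  let W := ((n %/ (32 * k ^ 2 * k1)) * M)%N in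
  [/\ (3 <= 32 * k ^ 2 * k1)%N /\ (4 <= n)%N,
      (0 < m)%N /\ (2 * m <= n)%N, (0 < M)%N -> ((2 * W).+1 <= n * M)%N,
      (n <= 2 * (k1 * m))%N & (M <= E.+1 * k)%N].
Proof.
move=> k2 k12; set K := (32 * k ^ 2 * k1)%N => nK m E W.
have k10 : (0 < k1)%N by lia.
have k0 : (0 < k)%N by lia.
have K32 : (32 * k1 <= K)%N.
  by rewrite /K -mulnA mulnCA leq_pmull // expn_gt0 k0.
clearbody K.
have n4 : (4 <= n)%N by lia.
have km : (m * k1 <= n)%N by exact: leq_divM.
have hc : (n < m.+1 * k1)%N by exact: ltn_ceil.
have m0 : (0 < m)%N by rewrite divn_gt0 //; lia.
split; [by split; lia | by split => //; nia | | by nia | ].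
  move=> M0; have : (n %/ K * K <= n)%N by exact: leq_divM.
  rewrite /W; move: (n %/ K)%N => q hq.
  have : (3 * q <= n)%N by nia.
  clear -M0 n4; have [->|q0] := posnP q; nia.
by apply: ltnW; exact: ltn_ceil.
Qed.

Lemma sum_error_terms_le (R : realFieldType)
    (P Q u c th b3 b4 b5 r2 r3 r4 r5 x : R) :
  P - Q * u + 1 <= c + 2 * th -> th <= r2 / x -> b3 <= r3 / x ->
  b4 <= r4 / x -> b5 <= r5 / x ->
  P + b3 + b4 - Q * u + 1 + b5 <= c + (2 * r2 + r3 + r4 + r5) / x.
Proof. by rewrite !mulrDl; lra. Qed.

(** The parameters are [m = n %/ k1], [E = M %/ k], [W = (n %/ K) * M] and [T = |tau| + W]. The
    constant [A] is uniform in [n], [M] and [tau], so [k] can be chosen first to make [34 / k]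
    small, and [n] sent to infinity afterwards. *)
Lemma unsolvable_fraction_le (R : realType) (d k k1 : nat) (eps : R) :
  (1 < d)%N -> 0 < eps -> (2 <= k)%N -> (2 <= k1)%N -> k1%:R^-1 <= eps / 4 ->
  exists A : R, forall (n M : nat) (tau : int),
    (2 * (32 * k ^ 2 * k1) <= n)%N -> (k <= M)%N ->
    (`|tau| * (32 * k ^ 2 * k1) <= M * n)%N ->
    M%:R <= #|` coefs d|%:R `^ ((1 - eps) * n%:R) ->
    #|~: solvable_instances n M (coefs d) tau|%:R / M%:R ^+ n
      <= 34 / k%:R + A / n%:R.
Proof.
move=> d1 eps0 k2 k12 k1eps; set K := (32 * k ^ 2 * k1)%N.
set N := #|` coefs d|.
(* The summands come from the Chebyshev term, the pairs without coincidence, the diagonal, and the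
   steering blocks of small mass. *)
exists (2 * (9 * K%:R ^+ 2 * d%:R ^+ 2) + 6 / ((4 * N%:R ^+ 2)^-1) ^+ 3
  + N%:R * (6 / (3 / 4 * eps * ln N%:R) ^+ 3) + 16 * k%:R * k1%:R).
move=> n M tau nK kM tK hM.
have [C1 Cm C2] := coefs_unit_two d1.
have N1 := card_coefs_gt1 d1; rewrite -/N in N1.
have M0 : (0 < M)%N by apply: leq_trans kM; apply: ltn_trans k2.
have [[K3 n4] [m0 mn] /(_ M0) hU hm hE1] := parameters_bounds M k2 k12 nK.
have [E0 EM MW hT] := parameters_admissible k2 k12 nK kM tK.
have mk1 : (n %/ k1 * k1 <= n)%N by exact: leq_divM.
have tT : `|tau| + (n %/ K * M)%:Z <= (absz tau + n %/ K * M)%:Z.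
  by rewrite PoszD abszE.
have eE : (M %/ k * k <= M)%N by exact: leq_divM.
rewrite -/K in hT MW hU K3 nK.
move: (n %/ k1)%N hT m0 mn hm mk1 => m hT m0 mn hm mk1.
move: (M %/ k)%N E0 EM hT hE1 eE => E E0 EM hT hE1 eE.
have [W WE] : exists W, W = (n %/ K * M)%N by exists (n %/ K * M)%N.
rewrite -!WE in hT MW hU tT.
have K0 : (0 < K)%N by apply: ltn_trans K3.
have {k12} k10 : (0 < k1)%N by apply: ltn_trans k12.
have k0 : (0 < k)%N by apply: ltn_trans k2.
have n0 : (0 < n)%N by apply: ltn_trans n4.
pose b := (n - 1 - m)%N.
have nE : n = (1 + b + m)%N by rewrite /b; clear -mn n4; lia.
have nR : 0 < n%:R :> R by rewrite ltr0n.
have kR : 2 <= k%:R :> R by rewrite ler_nat.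
have MR : 0 < M%:R :> R by rewrite ltr0n.
have k1R : 0 < k1%:R :> R by rewrite ltr0n.
have mR : 0 < m%:R :> R by rewrite ltr0n.
have hb : n%:R - 1 - eps / 4 * n%:R <= b%:R :> R.
  have -> : b%:R = n%:R - 1 - m%:R :> R by rewrite {1}nE !natrD; ring.
  rewrite lerD2l lerN2; apply: (@le_trans _ _ (n%:R / k1%:R)).
    by rewrite ler_pdivlMr // -natrM ler_nat.
  by rewrite mulrC ler_wpM2r // ltW.
have nb : (n <= 4 * b)%N.
  by rewrite /b; clear -mn n4; lia.
have bn : (b <= n)%N by rewrite /b -subnDA leq_subr.
have := @unsolvable_count R n b m M E (absz tau + W) W d (coefs d) tau
  nE C1 Cm C2 (sum_coefs d) (@normz_coefs_le d) E0 EM MW tT hT.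
rewrite mulrC -ler_pdivrMr ?exprn_gt0 //.
move=> /le_trans; apply.
rewrite -/N /miss_rate.
have e1 : 0 <= (E%:R : R) / M%:R <= k%:R^-1.
  rewrite divr_ge0 //= ler_pdivrMr // mulrC ler_pdivlMr; last by rewrite ltr0n.
  by rewrite -natrM ler_nat.
have th0 : 0 <= b%:R * (M%:R * d%:R) ^+ 2 / (W%:R - M%:R) ^+ 2 :> R.
  by apply: divr_ge0; [apply: mulr_ge0 => //|]; exact: sqr_ge0.
have t1 := rational_part_le kR e1 th0.
have t2 := @variance_term_le R n b M W K d M0 K0 nK bn WE.
have t3 := @window_term_le R n b M _ N n0 M0 N1 hU nb.
have t4 := @diagonal_term_le R n b M _ N eps n0 M0 N1 eps0 hU hb hM.
have t5 : 8 * M%:R / (m%:R * E.+1%:R) <= 16 * k%:R * k1%:R / n%:R :> R.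
  rewrite ler_pdivrMr ?mulr_gt0 ?ltr0n // mulrAC ler_pdivlMr //.
  rewrite -!natrM ler_nat.
  have := leq_mul hm hE1; clear; nia.
exact: sum_error_terms_le t1 t2 t3 t4 t5.
Qed.

Theorem mainTheorem4 (R : realType) (d : nat) (hd : (1 < d)%N)
    (eps : R) (heps : 0 < eps)
    (M : nat -> nat) (tau : nat -> int)
    (hM : exists2 a : R, 0 < a &
      \forall n \near \oo,
        (#|` coefs d|%fset%:R : R) `^ (a * n%:R) <= (M n)%:R)
    (htau : (fun n : nat => `|(tau n)%:~R| : R^o) =o_\oo
            (fun n : nat => (M n)%:R * n%:R : R^o)) :
  exists2 e : nat -> R, e n @[n --> \oo] --> (0 : R) &
    forall n : nat, (0 < n)%N ->
      let C := coefs d in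
      let Pr := unif_prob R (solvable_instances n (M n) C (tau n)) in
      ((M n)%:R <= (#|` C|%fset%:R : R) `^ ((1 - eps) * n%:R) ->
         1 - e n <= Pr) /\
      ((#|` C|%fset ^ n <= M n)%N ->
         Pr <= #|` C|%fset%:R ^+ n / (M n)%:R).
Proof.
pose Pr n := unif_prob R (solvable_instances n (M n) (coefs d) (tau n)).
have N1 := card_coefs_gt1 hd.
have N0 : 0 < #|` coefs d|%:R :> R by rewrite ltr0n; apply: ltn_trans N1.
have L0 : 0 < ln #|` coefs d|%:R :> R by rewrite ln_gt0 // ltr1n.
(* The error is the exact failure probability in the range of the lower bound and zero elsewhere, so
   only its convergence needs work. *)
exists (fun n => if (M n)%:R <= (#|` coefs d|%:R : R) `^ ((1 - eps) * n%:R)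
                 then 1 - Pr n else 0); last first.
  move=> n n0 C /=; split=> [-> |hMn]; first by rewrite subKr.
  have M0 : (0 < M n)%N by apply: leq_trans hMn; rewrite expn_gt0 (ltnW N1).
  have MR : 0 < (M n)%:R :> R by rewrite ltr0n.
  have C0 : 0 \notin coefs d by rewrite mem_coefs.
  have := @solvable_count_le R n (M n) C (tau n) n0 C0.
  rewrite /unif_prob card_ffun !card_ord natrX.
  by rewrite ler_pdivrMr ?exprn_gt0 // mulrAC ler_pdivlMr // mulrC.
apply/cvgrPdist_le => gam gam0.
(* This makes [34 / k] at most [gam / 2]; the two successors give both a strict upper bound on
   [68 / gam] and [k >= 2]. *)
pose k := (Num.truncn (68 / gam)).+2.
pose k1 := (Num.truncn (4 / eps)).+2.
have kR : 34 / k%:R <= gam / 2.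
  have : 68 / gam < k%:R.
    by apply: lt_le_trans (truncnS_gt _) _; rewrite ler_nat.
  rewrite ltr_pdivrMr // => h; rewrite ler_pdivrMr ?ltr0n //; lra.
have k1R : k1%:R^-1 <= eps / 4.
  rewrite -[leRHS]invf_div lef_pV2 ?posrE ?divr_gt0 ?ltr0n //.
  by apply: ltW; apply: lt_le_trans (truncnS_gt _) _; rewrite ler_nat.
have [//|//|A hA] := @unsolvable_fraction_le R d k k1 eps hd heps _ _ k1R.
case: hM => a a0 hM.
have K0 : 0 < ((32 * k ^ 2 * k1)%N%:R)^-1 :> R.
  by rewrite invr_gt0 ltr0n !muln_gt0.
(* The little-o hypothesis is used only with the fixed constant [1 / (32 k^2 k1)]. *)
have htau' := (eqoP _ _ _).1 htau _ K0.
near=> n.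
have n0 : (0 < n)%N by near: n; exact: nbhs_infty_gt.
have nR : 0 < n%:R :> R by rewrite ltr0n.
have nK : (2 * (32 * k ^ 2 * k1) <= n)%N by near: n; exact: nbhs_infty_ge.
have nA : A / n%:R <= gam / 2.
  rewrite ler_pdivrMr // mulrC -ler_pdivrMr ?divr_gt0 //.
  by near: n; exact: nbhs_infty_ger.
(* The exponential lower bound on [M n] makes it exceed [k] eventually, via [expR x >= 1 + x]. *)
have kM : (k <= M n)%N.
  rewrite -(ler_nat R); apply: (@le_trans _ _ (#|` coefs d|%:R `^ (a * n%:R))).
    rewrite /powR gt_eqF //; apply: le_trans (expR_ge1Dx _).
    apply: ltW; apply: ltr_wpDl => //.
    rewrite mulrAC -ltr_pdivrMl ?mulr_gt0 //.
    by near: n; exact: nbhs_infty_gtr.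
  by near: n.
have tK : (absz (tau n) * (32 * k ^ 2 * k1) <= M n * n)%N.
  have : `|(tau n)%:~R| <= ((32 * k ^ 2 * k1)%N%:R)^-1 * ((M n)%:R * n%:R) :> R.
    have : `| (`|(tau n)%:~R : R| : R^o) | <= ((32 * k ^ 2 * k1)%N%:R)^-1 *
      `|(M n)%:R * n%:R : R^o| by near: n.
    by rewrite normr_id [X in _ <= _ * X -> _]ger0_norm // mulr_ge0.
  rewrite mulrC ler_pdivlMr ?ltr0n ?muln_gt0 //.
  by rewrite -intr_norm -abszE -pmulrn -!natrM ler_nat.
case: ifP => [hMn|_]; last by rewrite subrr normr0 ltW.
have M0 : 0 < (M n)%:R :> R by rewrite ltr0n; apply: leq_trans kM.
have PrE : 1 - Pr n = #|~: solvable_instances n (M n) (coefs d) (tau n)|%:R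
    / (M n)%:R ^+ n.
  have := cardsC (solvable_instances n (M n) (coefs d) (tau n)).
  rewrite /Pr /unif_prob !card_ffun !card_ord natrX => /(congr1 (fun j => j%:R : R)).
  rewrite natrD natrX => hD.
  have D0 : (M n)%:R ^+ n != 0 :> R by rewrite expf_neq0 // gt_eqF.
  apply: (mulIf D0); rewrite mulrBl mul1r !mulfVK //.
  by rewrite -hD addrAC subrr add0r.
rewrite sub0r normrN PrE ger0_norm ?divr_ge0 ?exprn_ge0 //.
apply: le_trans (hA n (M n) (tau n) nK kM tK hMn) _.
by lra.
Unshelve. all: end_near.
Qed.
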